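(* Let $\theta$ be an inner function and let $g\in L^\infty$. If $\theta\in\ker D^\theta_g$ and $\overline z \in \ker D^\theta_g$, then $D^\theta_g=0$.
   Context: $L^2=L^2(\mathbb T)$, $L^\infty=L^\infty(\mathbb T)$, where $\mathbb T$ is the unit circle; $H^2_+=H^2(\mathbb D)$ is the Hardy space of the disc identified with boundary functions on $\mathbb T$; $H^2_-=L^2\ominus H^2_+$. $K_\theta=H^2_+\ominus\theta H^2_+$, $K_\theta^\perp=L^2\ominus K_\theta=H^2_-\oplus\theta H^2_+$, and $Q_\theta$ is the orthogonal projection of $L^2$ onto $K_\theta^\perp$. The dual truncated Toeplitz operator with symbol $g\in L^\infty$ is $D^\theta_g:K_\theta^\perp\to K_\theta^\perp$, $D^\theta_g f=Q_\theta(gf)$. Here $\overline z$ denotes the function $z\mapsto\overline z$ on $\mathbb T$. *)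

(* Defs.v *)
From HB Require Import structures.
From mathcomp Require Import all_boot all_order all_algebra.
From mathcomp Require Import complex.
From mathcomp Require Import all_classical all_reals all_analysis.

Set Implicit Arguments.
Unset Strict Implicit.
Unset Printing Implicit Defensive.

Import Order.TTheory GRing.Theory Num.Theory.
Import numFieldNormedType.Exports.
Import ComplexField.

Local Open Scope classical_set_scope.
Local Open Scope ring_scope.
Local Open Scope complex_scope.

Section circle.
Variable R : realType.

Definition circle := {z : R[i] | `|z| == 1}.

HB.instance Definition _ := Choice.on circle.

Lemma norm_expi (t : R) : `|cos t +i* sin t| == 1 :> R[i].
Proof. by rewrite normc_def /= cos2Dsin2 sqrtr1. Qed.

Definition expi (t : measurableTypeR R) : circle :=
  exist _ (cos t +i* sin t) (norm_expi t).

HB.instance Definition _ := isPointed.Build circle (expi 0).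

(* The image sigma-algebra of the Borel sets of R under [expi]. Since [expi]
   restricts to a homeomorphism from ]0, 2 pi[ onto the circle minus a point,
   these are exactly the Borel sets of the circle. *)
Definition circle_measurable : set (set circle) :=
  [set A | measurable (expi @^-1` A)].

Lemma circle_measurable0 : circle_measurable set0.
Proof. by rewrite /circle_measurable /= preimage_set0. Qed.

Lemma circle_measurableC A : circle_measurable A -> circle_measurable (~` A).
Proof. by rewrite /circle_measurable /= preimage_setC => /measurableC. Qed.

Lemma circle_measurable_bigcup (F : (set circle)^nat) :
  (forall i, circle_measurable (F i)) -> circle_measurable (\bigcup_i F i).
Proof.
by rewrite /circle_measurable /= preimage_bigcup => mF; apply: bigcupT_measurable.
Qed.

HB.instance Definition _ := isMeasurable.Build default_measure_display circle
  circle_measurable0 circle_measurableC circle_measurable_bigcup.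

Lemma measurable_expi : measurable_fun [set: measurableTypeR R] expi.
Proof. by move=> _ A mA; rewrite setTI. Qed.

HB.instance Definition _ := isMeasurableFun.Build _ _ _ _ expi measurable_expi.

Lemma pi2_gt0 : 0 < 2 * pi :> R.
Proof. by rewrite mulr_gt0// pi_gt0. Qed.

(* normalized arc length *)
Definition arclength : probability circle R :=
  distribution (uniform_prob pi2_gt0) expi.

Implicit Types (f g h theta : circle -> R[i]) (F : R[i] -> R[i]).
Implicit Types V W : set (circle -> R[i]).

Definition ae_equal f g := {ae arclength, forall z, f z = g z}.

Definition cmeasurable f :=
  measurable_fun [set: circle] (fun z => complex.Re (f z)) /\
  measurable_fun [set: circle] (fun z => complex.Im (f z)).

(* Elements of L^2 and L^oo are represented by measurable functions, and
   equality in these spaces is [ae_equal]. *)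
Definition L2 : set (circle -> R[i]) :=
  [set f | cmeasurable f /\
           (\int[arclength]_z (Normc.normc (f z) ^+ 2)%:E < +oo)%E].

Definition Linfty : set (circle -> R[i]) :=
  [set f | cmeasurable f /\
           exists M : R, {ae arclength, forall z, Normc.normc (f z) <= M}].

Definition cintegral f : R[i] :=
  Rintegral arclength [set: circle] (fun z => complex.Re (f z)) +i*
  Rintegral arclength [set: circle] (fun z => complex.Im (f z)).

Definition inner_prod f g : R[i] := cintegral (fun z => f z * (g z)^*).

(* V (-) W: the elements of V orthogonal to W *)
Definition ominus V W : set (circle -> R[i]) :=
  [set f | V f /\ forall h, W h -> inner_prod f h = 0].

(* A representative of the orthogonal projection of f onto the subspace W of
   L^2. It exists, and is unique up to [ae_equal], when f is in L^2 and W is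
   closed; the default value f is irrelevant in that case. *)
Definition orth_proj W f : circle -> R[i] :=
  xget f [set h | W h /\ forall w, W w -> inner_prod (f \- h) w = 0].

Definition analytic_disc F := exists a : R[i]^nat, forall z : R[i],
  `|z| < 1 -> series (fun k => a k * z ^+ k) @ \oo --> (F z : R[i]^o).

Definition hardy2_disc F := analytic_disc F /\
  exists M : R, forall r : R, 0 <= r < 1 ->
    (\int[arclength]_z (Normc.normc (F (r%:C * val z)) ^+ 2)%:E <= M%:E)%E.

Definition hardy_infty_disc F := analytic_disc F /\
  exists M : R, forall z : R[i], `|z| < 1 -> Normc.normc (F z) <= M.

(* f is the boundary function of F: radial limits almost everywhere *)
Definition boundary_fun F f :=
  {ae arclength, forall z,
    F (r%:C * val z) @[r --> (1 : R)^'-] --> (f z : R[i]^o)}.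

Definition H2 : set (circle -> R[i]) :=
  [set f | L2 f /\ exists2 F, hardy2_disc F & boundary_fun F f].

Definition inner_function theta := [/\ cmeasurable theta,
  exists2 F, hardy_infty_disc F & boundary_fun F theta &
  {ae arclength, forall z, `|theta z| = 1}].

Definition model_space theta : set (circle -> R[i]) :=
  ominus H2 [set (theta \* h : circle -> R[i]) | h in H2].

Definition model_perp theta : set (circle -> R[i]) :=
  ominus L2 (model_space theta).

Definition proj_model_perp theta f : circle -> R[i] :=
  orth_proj (model_perp theta) f.

(* D^theta_g, as an operator on [model_perp theta] *)
Definition dual_toeplitz theta g f : circle -> R[i] :=
  proj_model_perp theta (g \* f).

Definition dual_toeplitz_ker theta g : set (circle -> R[i]) :=
  [set f | model_perp theta f /\ ae_equal (dual_toeplitz theta g f) (cst 0)].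

Definition zbar : circle -> R[i] := fun z => (val z)^*.

End circle.

(* Main.v *)
Require Import Defs.
From mathcomp Require Import all_boot all_order all_algebra.
From mathcomp Require Import complex.
From mathcomp Require Import all_classical all_reals all_analysis.
From mathcomp Require Import measurable_realfun ring lra.

(** The two kernel conditions force the symbol itself to vanish almost
    everywhere, through orthogonality relations alone.

    If f is in the kernel of D_g, then g f is orthogonal to W = K_theta^perp
    ([dual_toeplitz_ker_orth]). For h in H^2 the function z h
    is again in H^2 ([H2X]), and theta z h is in W ([inner_mul_H2_perp]).
    Hence, as theta is unimodular on the circle,
      0 = <g theta, theta z h> = <g, z h> = <g zbar, h>,
    so g zbar is orthogonal to H^2. Since K_theta is contained in H^2, it
    follows that g zbar lies in W. The second kernel condition says that
    g zbar is orthogonal to W; so it is orthogonal to itself and vanishes,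
    and g vanishes with it ([symbol_eq0]).

    Elements of L^2 are functions here, so D_g f = 0 still requires that the
    chosen representative of the projection of a null function is null
    ([orth_proj_ae0]). *)

Set Implicit Arguments.
Unset Strict Implicit.
Unset Printing Implicit Defensive.

Import Order.TTheory GRing.Theory Num.Theory.
Import numFieldNormedType.Exports.
Import ComplexField.

Local Open Scope classical_set_scope.
Local Open Scope ring_scope.
Local Open Scope complex_scope.

(** * Products of limits *)

(** Stated over an abstract field: the algebraic and topological structures of
    R[i]^o do not unify with those expected by [cvgM], but an instance of the
    conclusion at R[i] is convertible to the goals below. *)
Lemma cvgM_regular (K : numFieldType) T (F : set_system T) (FF : Filter F)
  (f g : T -> K) (k l : K) :
  f x @[x --> F] --> (k : K^o) -> g x @[x --> F] --> (l : K^o) ->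
  f x * g x @[x --> F] --> (k * l : K^o).
Proof. exact: (@cvgM K T F FF). Qed.

Section dual_toeplitz.
Variable R : realType.
Implicit Types (f g h u v theta : circle R -> R[i]) (F : R[i] -> R[i]).
Implicit Types V W : set (circle R -> R[i]).

(** * Complex moduli *)

Lemma sqr_normc (x : R[i]) :
  Normc.normc x ^+ 2 = complex.Re x ^+ 2 + complex.Im x ^+ 2.
Proof. by case: x => a b /=; rewrite sqr_sqrtr// addr_ge0// sqr_ge0. Qed.

Lemma mulc_conj (x : R[i]) : x * x^* = (Normc.normc x ^+ 2)%:C.
Proof.
rewrite sqr_normc; case: x => a b; apply/eqP; rewrite eq_complex /=.
by apply/andP; split; apply/eqP; ring.
Qed.

Lemma normcM_sqr (x y : R[i]) :
  Normc.normc (x * y) ^+ 2 = Normc.normc x ^+ 2 * Normc.normc y ^+ 2.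
Proof. by rewrite Normc.normcM exprMn. Qed.

Lemma normc_eq1 (x : R[i]) : `|x| = 1 -> Normc.normc x = 1.
Proof. by case: x => a b; rewrite normc_def => -[]. Qed.

Lemma normc_circle (z : circle R) : Normc.normc (val z) = 1.
Proof. exact: (normc_eq1 (eqP (valP z))). Qed.

(** * Measurability *)

Lemma cmeasurableM f g :
  cmeasurable f -> cmeasurable g -> cmeasurable (f \* g).
Proof.
move=> [mf1 mf2] [mg1 mg2]; split.
  rewrite (_ : (fun z => _) = (fun z => complex.Re (f z) * complex.Re (g z) -
    complex.Im (f z) * complex.Im (g z))); last first.
    by apply/funext => z /=; case: (f z) (g z) => [a b] [c d].
  by apply: measurable_funB; apply: measurable_funM.
rewrite (_ : (fun z => _) = (fun z => complex.Re (f z) * complex.Im (g z) +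
  complex.Im (f z) * complex.Re (g z))); last first.
  by apply/funext => z /=; case: (f z) (g z) => [a b] [c d].
by apply: measurable_funD; apply: measurable_funM.
Qed.

Lemma cmeasurable_conj f : cmeasurable f -> cmeasurable (fun z => (f z)^*).
Proof.
move=> [mf1 mf2]; split.
  rewrite (_ : (fun z => _) = (fun z => complex.Re (f z)))//.
  by apply/funext => z; case: (f z).
rewrite (_ : (fun z => _) = (fun z => - complex.Im (f z))).
  exact: measurable_funN.
by apply/funext => z; case: (f z).
Qed.

Lemma cmeasurableB f g :
  cmeasurable f -> cmeasurable g -> cmeasurable (f \- g).
Proof.
move=> [mf1 mf2] [mg1 mg2]; split.
  rewrite (_ : (fun z => _) = (fun z => complex.Re (f z) - complex.Re (g z))).
    exact: measurable_funB.
  by apply/funext => z /=; case: (f z) (g z) => [a b] [c d].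
rewrite (_ : (fun z => _) = (fun z => complex.Im (f z) - complex.Im (g z))).
  exact: measurable_funB.
by apply/funext => z /=; case: (f z) (g z) => [a b] [c d].
Qed.

Lemma cmeasurable_val : cmeasurable (fun z : circle R => val z).
Proof.
have mcont (u : R -> R) : continuous u -> measurable_fun [set: R] u.
  exact: continuous_measurable_fun.
split=> _ A mA.
- by have := mcont _ (@continuous_cos R) measurableT _ mA; rewrite !setTI.
- by have := mcont _ (@continuous_sin R) measurableT _ mA; rewrite !setTI.
Qed.

Lemma measurable_sqr_normc f : cmeasurable f ->
  measurable_fun [set: circle R] (fun z => (Normc.normc (f z) ^+ 2)%:E).
Proof.
move=> [mf1 mf2]; apply/measurable_EFinP.
rewrite (_ : (fun z => _) =
  (fun z => complex.Re (f z) ^+ 2 + complex.Im (f z) ^+ 2)).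
  by apply: measurable_funD; apply: measurable_funX.
by apply/funext => z; rewrite sqr_normc.
Qed.

(** * Integrals and inner products on the circle *)

Lemma cintegral_ae u v : cmeasurable u -> cmeasurable v -> ae_equal u v ->
  cintegral u = cintegral v.
Proof.
move=> [mu1 mu2] [mv1 mv2] uv.
by congr (_ +i* _); congr fine; apply: ae_eq_integral => //;
  try exact/measurable_EFinP; apply: filterS uv => z /= ->.
Qed.

(** Holds for every f: when the positive and the negative part both have infinite
    integral, the integrals of f and of its opposite are -oo, and [fine] sends
    -oo to 0. *)
Lemma RintegralN_total d (T : measurableType d) (mu : measure T R)
  (f : T -> R) :
  Rintegral mu [set: T] (fun z => - f z) = - Rintegral mu [set: T] f.
Proof.
rewrite /Rintegral integralE [in RHS]integralE.
rewrite (_ : (fun z => (- f z)%:E) = (fun z => - (f z)%:E)%E)//.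
rewrite funeposN funenegN.
by case: integral => [a| |]; case: integral => [b| |] //=; rewrite ?oppr0//;
  lra.
Qed.

Lemma cintegral_conj f : cintegral (fun z => (f z)^*) = (cintegral f)^*.
Proof.
rewrite /cintegral /= -RintegralN_total.
by congr (_ +i* _); apply: eq_Rintegral => z _; case: (f z).
Qed.

Lemma inner_prodC f g : inner_prod g f = (inner_prod f g)^*.
Proof.
rewrite /inner_prod -cintegral_conj; congr cintegral; apply/funext => z.
by rewrite rmorphM /= conjcK mulrC.
Qed.

Lemma cintegralN f : cintegral (fun z => - f z) = - cintegral f.
Proof.
rewrite /cintegral; apply/eqP; rewrite eq_complex /= -!RintegralN_total.
by apply/andP; split; apply/eqP; apply: eq_Rintegral => z _; case: (f z).
Qed.

(** Finiteness of the L^2 norm matters: [fine] would also send an infinite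
    integral to 0. *)
Lemma inner_prod_self_eq0 f : L2 f -> inner_prod f f = 0 ->
  ae_equal f (cst 0).
Proof.
move=> [mf foo] ff0.
have mn := measurable_sqr_normc mf.
have n0 (z : circle R) : (0 <= (Normc.normc (f z) ^+ 2)%:E)%E.
  by rewrite lee_fin sqr_ge0.
have i0 : (\int[@arclength R]_z (Normc.normc (f z) ^+ 2)%:E = 0)%E.
  have ReE : fine (\int[@arclength R]_z (Normc.normc (f z) ^+ 2)%:E)%E = 0.
    apply: etrans (congr1 (@complex.Re R) ff0).
    by congr fine; apply: eq_integral => z _; rewrite mulc_conj.
  rewrite -[LHS]fineK ?ReE// ge0_fin_numE//.
  exact: integral_ge0.
have /(ae_eq_integral_abs _ measurableT mn) :
    (\int[@arclength R]_z `|(Normc.normc (f z) ^+ 2)%:E| = 0)%E.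
  by rewrite -[RHS]i0; apply: eq_integral => z _; rewrite gee0_abs.
apply: filterS => z /(_ I) [] /eqP; rewrite sqrf_eq0 => /eqP.
exact: Normc.eq0_normc.
Qed.

Lemma cmeasurable0 : cmeasurable (cst 0 : circle R -> R[i]).
Proof. by split; exact: measurable_cst. Qed.

Lemma cintegral_ae0 u : cmeasurable u -> ae_equal u (cst 0) -> cintegral u = 0.
Proof.
move=> mu u0; rewrite (cintegral_ae mu cmeasurable0 u0).
by rewrite /cintegral /cst /= /Rintegral !integral0.
Qed.

Lemma inner_prodBl_ae0 f h w : cmeasurable f -> cmeasurable h ->
  cmeasurable w -> ae_equal h (cst 0) ->
  inner_prod (f \- h) w = inner_prod f w.
Proof.
move=> mf mh mw h0; have mcw := cmeasurable_conj mw.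
apply: cintegral_ae.
- by apply: cmeasurableM => //; exact: cmeasurableB.
- exact: cmeasurableM.
- by apply: filterS h0 => z /= ->; rewrite subr0.
Qed.

(** * Multiplication on L^2 and shift-invariance of H^2 *)

Lemma L2M f g : Linfty f -> L2 g -> L2 (f \* g).
Proof.
move=> [mf [M fM]] [mg goo]; have mfg := cmeasurableM mf mg.
split=> //.
have n0 u (z : circle R) : (0 <= (Normc.normc (u z) ^+ 2)%:E)%E.
  by rewrite lee_fin sqr_ge0.
apply: (@le_lt_trans _ _
    (\int[@arclength R]_z ((M ^+ 2)%:E * (Normc.normc (g z) ^+ 2)%:E)%E)%E).
  apply: ae_ge0_le_integral => //.
  - exact: measurable_sqr_normc.
  - by move=> z _; rewrite -EFinM lee_fin mulr_ge0// sqr_ge0.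
  - by apply: emeasurable_funM => //; exact: measurable_sqr_normc.
  - apply: filterS fM => z fzM _; rewrite /= normcM_sqr -EFinM lee_fin.
    rewrite ler_wpM2r ?sqr_ge0// ler_pXn2r// ?nnegrE//.
    + by case: (f z) => a b /=; rewrite sqrtr_ge0.
    + by apply: le_trans fzM; case: (f z) => a b /=; rewrite sqrtr_ge0.
rewrite ge0_integralZl_EFin// ?sqr_ge0//; last exact: measurable_sqr_normc.
by rewrite lte_mul_pinfty ?lee_fin ?sqr_ge0.
Qed.

Lemma mulc_conj_norm1 (x : R[i]) : Normc.normc x = 1 -> x * x^* = 1.
Proof. by rewrite mulc_conj => ->; rewrite expr1n. Qed.

Lemma unimodular_Linfty f : cmeasurable f ->
  {ae @arclength R, forall z, Normc.normc (f z) = 1} -> Linfty f.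
Proof.
by move=> mf f1; split=> //; exists 1; apply: filterS f1 => z ->.
Qed.

Lemma analytic_discX F : analytic_disc F -> analytic_disc (fun z => z * F z).
Proof.
move=> [a aF].
exists (fun k => if k is k'.+1 then a k' else 0) => z z1.
rewrite -(@cvg_shiftS R[i]^o).
(* dropping the null constant term leaves z times the series of F *)
have -> : [sequence (series (fun k => (if k is k'.+1 then a k' else 0) * z ^+ k))
      n.+1]_n = (fun n => z * series (fun k => a k * z ^+ k) n).
  apply/funext => n; rewrite /series /= big_nat_recl// mul0r add0r.
  rewrite big_distrr /=; apply: eq_bigr => k _.
  by rewrite exprS mulrCA.
apply: cvgM_regular; [exact: cvg_cst|exact: aF z1].
Qed.

(** Comparing the integrals through their definition as suprema over simple
    functions avoids proving that F is measurable on circles. *)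
Lemma hardy2_discX F : hardy2_disc F -> hardy2_disc (fun z => z * F z).
Proof.
move=> [aF [M FM]]; split; first exact: analytic_discX.
exists M => r r01; apply: le_trans (FM r r01).
rewrite !ge0_integralTE; [|by move=> z; rewrite lee_fin sqr_ge0..].
apply: ereal_sup_le => _ [h hF <-]; exists h => // z.
apply: le_trans (hF z) _; rewrite lee_fin normcM_sqr ler_piMl ?sqr_ge0//.
rewrite normcM_sqr normc_circle expr1n mulr1 /= expr0n addr0 sqrtr_sqr.
case/andP: r01 => r0 r1.
by rewrite ger0_norm// expr_le1 // ltW.
Qed.

Lemma H2X f : H2 f -> H2 (fun z => val z * f z).
Proof.
move=> [L2f [F hF Ff]]; split.
  apply: L2M L2f; apply: unimodular_Linfty; first exact: cmeasurable_val.
  by apply: aeW => z; exact: normc_circle.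
exists (fun z => z * F z); first exact: hardy2_discX.
rewrite /boundary_fun; have aeF : Filter (almost_everywhere (@arclength R)).
  exact: ae_filter_ringOfSetsType.
apply: filterS Ff => z Fz.
apply: cvgM_regular Fz.
rewrite -[X in _ --> X]mul1r.
apply: cvgM_regular; last exact: cvg_cst.
apply/cvgrPdist_lt => e; rewrite ltcE /= => /andP[/eqP ime e0].
near=> r.
(* a positive e is real, so the bound is one between real numbers *)
rewrite normc_def ltcE /= -ime eqxx /= subrr expr0n addr0 sqrtr_sqr.
have r1 : 0 <= 1 - r by rewrite subr_ge0; near: r; exact: nbhs_left_le.
by rewrite ger0_norm//; near: r; exact: nbhs_left_ltBl.
Unshelve. all: by end_near.
Qed.

(** * Orthogonal projections *)

(** If h is a projection of f on W, then 0 = <f - h, h> = - <h, h> as f is null.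
    If there is no projection, the default value of [orth_proj] is f itself. *)
Lemma orth_proj_ae0 W f : W `<=` @L2 R -> cmeasurable f ->
  ae_equal f (cst 0) -> ae_equal (orth_proj W f) (cst 0).
Proof.
move=> WL2 mf f0; rewrite /orth_proj.
case: xgetP => [h _ [Wh fh]|//].
have L2h := WL2 _ Wh; apply: inner_prod_self_eq0 => //.
have mh := L2h.1; have mch := cmeasurable_conj mh.
apply: oppr_inj; rewrite oppr0 -(fh _ Wh) /inner_prod -cintegralN.
have mhh := cmeasurableM mh mch.
apply: cintegral_ae.
- have := cmeasurableB cmeasurable0 mhh.
  by congr cmeasurable; apply/funext => z /=; rewrite sub0r.
- by apply: cmeasurableM => //; exact: cmeasurableB.
- by apply: filterS f0 => z /= ->; rewrite sub0r mulNr.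
Qed.

(** A null projection h gives <f, w> = <f - h, w> = 0 for w in W; when there is
    no projection, the hypothesis says that f itself is null. *)
Lemma orth_of_orth_proj_ae0 W f : W `<=` @L2 R -> cmeasurable f ->
  ae_equal (orth_proj W f) (cst 0) -> forall w, W w -> inner_prod f w = 0.
Proof.
move=> WL2 mf; rewrite /orth_proj.
case: xgetP => [h _ [Wh fh] h0 w Ww|_ f0 w Ww].
  by rewrite -(inner_prodBl_ae0 mf (WL2 _ Wh).1 (WL2 _ Ww).1 h0) fh.
apply: cintegral_ae0.
  by apply: cmeasurableM => //; apply: cmeasurable_conj; exact: (WL2 _ Ww).1.
by apply: filterS f0 => z /= ->; rewrite mul0r.
Qed.

(** * Kernels of dual truncated Toeplitz operators *)

Lemma ominus_sub V W : ominus V W `<=` V.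
Proof. by move=> f []. Qed.

Lemma ominusS V W1 W2 : W1 `<=` W2 -> ominus V W2 `<=` ominus V W1.
Proof. by move=> W12 f [Vf fW]; split=> // h /W12; exact: fW. Qed.

(** The elements of K_theta are orthogonal to theta H^2 by definition. *)
Lemma inner_mul_H2_perp theta h : inner_function theta -> H2 h ->
  model_perp theta (theta \* h).
Proof.
move=> [mtheta _ theta1] H2h; split.
  apply: L2M H2h.1; apply: unimodular_Linfty => //.
  by apply: filterS theta1 => z; exact: normc_eq1.
move=> k [_ kperp]; rewrite inner_prodC kperp ?conjc0//.
by exists h.
Qed.

Lemma dual_toeplitz_ker_orth theta g f : Linfty g ->
  dual_toeplitz_ker theta g f ->
  forall w, model_perp theta w -> inner_prod (g \* f) w = 0.
Proof.
move=> gL [[[mf _] _] Df0].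
apply: orth_of_orth_proj_ae0 Df0; first exact: ominus_sub.
exact: cmeasurableM gL.1 mf.
Qed.

(** The first kernel condition places g zbar in K_theta^perp, the second makes
    it orthogonal to K_theta^perp, hence to itself. *)
Lemma symbol_eq0 theta g : inner_function theta -> Linfty g ->
  dual_toeplitz_ker theta g theta -> dual_toeplitz_ker theta g (@zbar R) ->
  ae_equal g (cst 0).
Proof.
move=> itheta gL kertheta kerz.
have [mtheta _ theta1] := itheta.
have mz := cmeasurable_val; have mzb := cmeasurable_conj mz.
have L2gz : L2 (g \* @zbar R) := L2M gL kerz.1.1.
have gzH2 : ominus (@L2 R) (@H2 R) (g \* @zbar R).
  split=> // h H2h.
  (* <g zbar, h> = <g theta, theta z h>, because |theta| = 1 *)
  have H2zh := H2X H2h; have mh := H2h.1.1; have mzh := H2zh.1.1.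
  rewrite -[RHS](dual_toeplitz_ker_orth gL kertheta (inner_mul_H2_perp itheta
    H2zh)).
  apply: cintegral_ae.
  - by apply: cmeasurableM; [exact: L2gz.1|exact: cmeasurable_conj].
  - apply: cmeasurableM; first exact: cmeasurableM gL.1 mtheta.
    by apply: cmeasurable_conj; exact: cmeasurableM.
  - apply: filterS theta1 => z /normc_eq1/mulc_conj_norm1 thz /=.
    rewrite !rmorphM /= [RHS](_ : _ = g z * (theta z * (theta z)^* ) *
      ((val z)^* * (h z)^* )); last by ring.
    by rewrite thz mulr1 /zbar mulrA.
have gzW : model_perp theta (g \* @zbar R).
  exact: ominusS (@ominus_sub _ _) _ gzH2.
have := inner_prod_self_eq0 L2gz (dual_toeplitz_ker_orth gL kerz gzW).
apply: filterS => z /= gz0.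
have zz := mulc_conj_norm1 (normc_circle z).
by rewrite -[g z]mulr1 -zz [val z * _]mulrC mulrA gz0 mul0r.
Qed.

End dual_toeplitz.

Theorem corollary4p13 (R : realType) (theta g : circle R -> R[i])
  (theta_inner : inner_function theta) (g_Linfty : Linfty g)
  (theta_ker : dual_toeplitz_ker theta g theta)
  (zbar_ker : dual_toeplitz_ker theta g (@zbar R)) :
  forall f : circle R -> R[i],
    model_perp theta f -> ae_equal (dual_toeplitz theta g f) (cst 0%R).
Proof.
move=> f Wf; apply: orth_proj_ae0; first exact: ominus_sub.
  exact: cmeasurableM g_Linfty.1 Wf.1.1.
have := symbol_eq0 theta_inner g_Linfty theta_ker zbar_ker.
by apply: filterS => z /= ->; rewrite mul0r.
Qed.
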